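(* Let $G$ be a finite group and $H$ a subgroup of $G$. If the core of $H$ in $G$ is not contained in the center of $G$, then there is no connected Cayley sum graph of $G$ admitting $H$ as a perfect code. In particular, if $H$ is normal in $G$ and not contained in the center of $G$, then $H$ is not a perfect code of any connected Cayley sum graph of $G$.
   Context: All groups are finite. A subset $X$ of $G$ is normal if $g^{-1}Xg=X$ for all $g\in G$. For a normal subset $X$ of $G$, the Cayley sum graph $\mathrm{CS}(G,X)$ is the simple graph with vertex set $G$ in which distinct vertices $g,h$ are adjacent iff $gh\in X$; a Cayley sum graph of $G$ is any such graph. A perfect code in a graph is an independent set $C$ of vertices such that every vertex outside $C$ has exactly one neighbour in $C$. The core of $H$ in $G$ is the largest normal subgroup of $G$ contained in $H$. *)

(* Defs.v *)
From mathcomp Require Import all_boot all_fingroup all_solvable.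

Set Implicit Arguments.
Unset Strict Implicit.
Unset Printing Implicit Defensive.

Import GroupScope.

(* A finite simple graph is given by its vertex set V : {set T} and a symmetric
   irreflexive adjacency relation e : rel T relating only elements of V. *)

Definition graph_connected (T : finType) (V : {set T}) (e : rel T) : Prop :=
  {in V &, forall x y : T, connect e x y}.

Definition perfect_code (T : finType) (V : {set T}) (e : rel T) (C : {set T}) :
    Prop :=
  [/\ C \subset V,
      {in C &, forall x y : T, ~~ e x y} &
      {in V :\: C, forall x : T, #|[set y in C | e x y]| = 1%N}].

Definition normal_subset (gT : finGroupType) (G : {group gT}) (X : {set gT}) :
    Prop :=
  X \subset G /\ {in G, forall g : gT, X :^ g = X}.

Definition cayley_sum (gT : finGroupType) (G : {group gT}) (X : {set gT}) :
    rel gT :=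
  [rel g h : gT | [&& g \in G, h \in G, g != h & g * h \in X]].

Lemma cayley_sum_irr (gT : finGroupType) (G : {group gT}) (X : {set gT}) :
  irreflexive (cayley_sum G X).
Proof. by move=> g; rewrite /cayley_sum /= eqxx !andbF. Qed.

Lemma cayley_sum_sym (gT : finGroupType) (G : {group gT}) (X : {set gT}) :
  normal_subset G X -> symmetric (cayley_sum G X).
Proof.
move=> [_ nX] g h; rewrite /cayley_sum /= eq_sym andbCA.
case Gh: (h \in G) => //=; case Gg: (g \in G) => //=; congr (_ && _).
by rewrite -{1}(nX h Gh) mem_conjg conjgE invgK !mulgA mulgK.
Qed.

(* Main.v *)
Require Import Defs.
From mathcomp Require Import all_boot all_fingroup all_solvable.
Import GroupScope.

(** Every left coset of H other than H itself contains exactly one element of X,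
    while X meets H at most in 1. If N is the core of H, x in X and n in N, then
    x ^ n lies in X and in x N, which is contained in x H, so x ^ n = x. Hence N
    centralizes X, and connectedness forces G = <<X>>. *)

Section PerfectCodeSubgroup.

Context {gT : finGroupType} {G H : {group gT}} {X : {set gT}}.

(** If [x * y] lies in [X], then [x] and [y] are both inside or both outside [<<X>>], so [<<X>>] is
    closed under adjacency; it contains [1]. *)
Lemma cayley_sum_connected_gen :
  graph_connected G (cayley_sum G X) -> G \subset <<X>>.
Proof.
move=> conn; apply/subsetP => g Gg.
have clX : closed (cayley_sum G X) (mem <<X>>).
  move=> x y /and4P[_ _ _ Xxy]; have {}Xxy := mem_gen Xxy.
  by apply/idP/idP => [Kx | Ky]; [rewrite -(groupMl y Kx) | rewrite -(groupMr x Ky)].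
by rewrite -[g \in _](closed_connect clX (conn 1 g (group1 G) Gg)) group1.
Qed.

(** A nontrivial [x] in both sets would be adjacent to [1], since [1 * x = x], against independence
    of [H]. *)
Lemma perfect_code_meet (sHG : H \subset G) :
  perfect_code G (cayley_sum G X) H -> X :&: H \subset [1].
Proof.
case=> _ indep _; apply/subsetP => x /setIP[Xx Hx]; rewrite inE.
have := indep 1 x (group1 H) Hx.
by rewrite /cayley_sum /= group1 (subsetP sHG) // mul1g Xx andbT negbK eq_sym.
Qed.

(** For [x] outside [H], any [h] in [H] with [x * h] in [X] is a neighbour of [x]. Both [1] and
    [x^-1 * y] are such, so they coincide. *)
Lemma perfect_code_lcoset_eq {x y : gT} (sHG : H \subset G) :
  perfect_code G (cayley_sum G X) H ->
  x \in G -> x \notin H -> x \in X -> y \in X -> y \in x *: H -> y = x.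
Proof.
case=> _ _ uniq_nbr Gx nHx Xx Xy; rewrite mem_lcoset => Hxy.
have nbr h : h \in H -> x * h \in X -> h \in [set z in H | cayley_sum G X x z].
  move=> Hh Xxh; rewrite inE Hh /cayley_sum /= Gx (subsetP sHG) // Xxh andbT /=.
  by apply: contraNneq nHx => ->.
have /eqP/cards1P[z defz] : #|[set z in H | cayley_sum G X x z]| = 1%N.
  by apply: uniq_nbr; rewrite inE nHx.
have /set1P e1 : 1 \in [set z] by rewrite -defz nbr ?mulg1.
have /set1P exy : x^-1 * y \in [set z] by rewrite -defz nbr ?mulKVg.
by apply: (mulgI x^-1); rewrite mulVg exy e1.
Qed.

Lemma perfect_code_gcore_cent (sHG : H \subset G) :
  normal_subset G X -> perfect_code G (cayley_sum G X) H ->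
  X \subset 'C(gcore H G).
Proof.
move=> [sXG nX] codeH; apply/subsetP => x Xx; have Gx := subsetP sXG x Xx.
have [Hx | nHx] := boolP (x \in H).
  suff /set1P-> : x \in [1] by apply: group1.
  by apply: (subsetP (perfect_code_meet sHG codeH)); rewrite inE Xx.
apply/centP => n Nn; apply/commgP/conjg_fixP.
have Hn := subsetP (gcore_sub H G) n Nn.
apply: (perfect_code_lcoset_eq sHG codeH Gx nHx Xx).
  by rewrite -(nX n (subsetP sHG n Hn)) memJ_conjg.
(* Here [x^-1 * x ^ n] is the commutator of [x] and [n], equal to [n^-1 ^ x * n], which lies in the
   core because [x] normalizes it. *)
rewrite mem_lcoset -/(commg x n) (subsetP (gcore_sub H G)) //.
rewrite commgEr groupM // memJ_norm ?groupV //.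
exact: (subsetP (gcore_norm H G)).
Qed.

Lemma perfect_code_gcore_center (sHG : H \subset G) :
  normal_subset G X -> graph_connected G (cayley_sum G X) ->
  perfect_code G (cayley_sum G X) H -> gcore H G \subset 'Z(G).
Proof.
(* Swapping the two sides of the centralizing relation leaves a group on the right, so checking the
   generators [X] suffices. *)
move=> nX conn codeH; rewrite subsetI (subset_trans (gcore_sub H G) sHG) centsC.
apply: subset_trans (cayley_sum_connected_gen conn) _.
by rewrite gen_subG; apply: perfect_code_gcore_cent.
Qed.

End PerfectCodeSubgroup.

Theorem theorem3p5 (gT : finGroupType) (G H : {group gT}) (sHG : H \subset G) :
  (~~ (gcore H G \subset 'Z(G)) ->
     ~ exists X : {set gT},
         [/\ normal_subset G X,
             graph_connected G (cayley_sum G X) &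
             perfect_code G (cayley_sum G X) H])
  /\
  (H <| G -> ~~ (H \subset 'Z(G)) ->
     forall X : {set gT},
       normal_subset G X ->
       graph_connected G (cayley_sum G X) ->
       ~ perfect_code G (cayley_sum G X) H).
Proof.
split=> [/negP nZ [X [nX conn codeH]] | nHG /negP nZ X nX conn codeH]; apply: nZ.
  exact: perfect_code_gcore_center nX conn codeH.
(* A normal [H] is contained in its own core. *)
apply: subset_trans (perfect_code_gcore_center sHG nX conn codeH).
by rewrite gcore_max ?normal_norm.
Qed.
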